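(* Let $R$ be a connected rack, and let $S$ be a rack for which the group $\mathrm{Inn}(S)$ is abelian. Suppose that there exists $s \in S$ such that for every $x \in S$ we have $x^s = x$. Let $X$ be a subset of $R \times S$ whose projection to $R$ generates $R$, and whose projection to $S$ generates $S$. Then $X$ generates $R \times S$.
   Context: A rack is a set $R$ with a binary operation $(x,y) \mapsto x^y$ such that for every $y \in R$ the map $x \mapsto x^y$ is a bijection on $R$, and $(x^y)^z = (x^z)^{y^z}$ for all $x,y,z \in R$. A subset of a rack is a subrack if it is a rack with respect to the operation of $R$; a subset generates $R$ if no proper subrack of $R$ contains it (equivalently the intersection of all subracks containing it is $R$). The product of racks $R \times S$ has the operation $(x,y)^{(z,w)} = (x^z, y^w)$. $\mathrm{Inn}(R)$ is the subgroup of $\mathrm{Aut}(R)$ generated by the automorphisms $x \mapsto x^y$ for $y \in R$. The connected components of $R$ are the orbits of $\mathrm{Inn}(R)$ on $R$ (equivalently of the structure group $\Gamma_R = \langle R : s^{-1}rs = r^s\rangle$); $R$ is connected if it has exactly one connected component (so the empty rack is not connected). *)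

(* Defs.v *)
From HB Require Import structures.
From mathcomp Require Import all_boot.
From mathcomp Require Import boolp classical_sets functions.

Set Implicit Arguments.
Unset Strict Implicit.
Unset Printing Implicit Defensive.

Local Open Scope classical_set_scope.

Declare Scope rack_scope.
Delimit Scope rack_scope with rack.
Local Open Scope rack_scope.

(* No choice, equality or finiteness structure is required: racks may be
   infinite, and may be empty. *)
HB.mixin Record isRack (R : Type) := {
  rack_op : R -> R -> R;
  rack_op_bij : forall y : R, bijective (fun x => rack_op x y);
  rack_op_distr : forall x y z : R,
    rack_op (rack_op x y) z = rack_op (rack_op x z) (rack_op y z)
}.

#[short(type="rackType")]
HB.structure Definition Rack := {R of isRack R}.

Notation "x ^ y" := (rack_op x y) : rack_scope.

Section Product.
Variables R S : rackType.

Definition prod_rack_op (p q : R * S) : R * S := (p.1 ^ q.1, p.2 ^ q.2).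

Lemma prod_rack_op_bij (q : R * S) : bijective (fun p => prod_rack_op p q).
Proof.
have [f fK Kf] := rack_op_bij q.1; have [g gK Kg] := rack_op_bij q.2.
exists (fun p => (f p.1, g p.2)) => -[x y]; rewrite /prod_rack_op /=.
  by rewrite fK gK.
by rewrite Kf Kg.
Qed.

Lemma prod_rack_op_distr (p q r : R * S) :
  prod_rack_op (prod_rack_op p q) r
  = prod_rack_op (prod_rack_op p r) (prod_rack_op q r).
Proof. by congr pair; apply: rack_op_distr. Qed.

HB.instance Definition _ :=
  isRack.Build (R * S)%type prod_rack_op_bij prod_rack_op_distr.

End Product.

Section RackTheory.
Variable R : rackType.

(* Self-distributivity is inherited from R, so A is a rack for the induced
   operation iff every x |-> x ^ y with y in A restricts to a bijection of A;
   on an infinite A, closure under the operation would not be enough. *)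
Definition subrack (A : set R) : Prop :=
  forall y, A y -> set_bij A A (fun x => x ^ y).

Definition generates (X : set R) : Prop :=
  forall A : set R, subrack A -> X `<=` A -> A = setT.

Definition Aut : set (R -> R) :=
  [set f | bijective f /\ forall x y, f (x ^ y) = f x ^ f y].

Definition subgroup_of_Aut (G : set (R -> R)) : Prop :=
  [/\ G `<=` Aut,
      G idfun,
      forall f g, G f -> G g -> G (f \o g) &
      forall f g, G f -> cancel f g -> cancel g f -> G g].

Definition Inn : set (R -> R) :=
  smallest subgroup_of_Aut [set (fun x => x ^ y) | y in [set: R]].

Lemma subgroup_of_Aut_Aut : subgroup_of_Aut Aut.
Proof.
split; first by [].
- by split; [exists idfun | by []].
- move=> f g [fb fM] [gb gM]; split; first exact: bij_comp.
  by move=> x y /=; rewrite gM fM.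
- move=> f g [_ fM] fK gK; split; first by exists f.
  by move=> x y; rewrite -{1}(gK x) -{1}(gK y) -fM fK.
Qed.

(* The family of subgroups intersected in Inn is nonempty, as it contains Aut. *)
Lemma Inn_sub_Aut : Inn `<=` Aut.
Proof.
apply: smallest_sub; first exact: subgroup_of_Aut_Aut.
move=> _ [y _ <-]; split; first exact: rack_op_bij.
by move=> x z; rewrite rack_op_distr.
Qed.

Definition Inn_abelian : Prop :=
  forall f g, Inn f -> Inn g -> f \o g = g \o f.

Definition Inn_orbit (x : R) : set R := [set f x | f in Inn].

Definition connected_components : set (set R) :=
  [set Inn_orbit x | x in [set: R]].

Definition rack_connected : Prop :=
  exists C : set R, connected_components = [set C].

End RackTheory.

Arguments Aut R : clear implicits.
Arguments Inn R : clear implicits.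
Arguments Inn_abelian R : clear implicits.
Arguments connected_components R : clear implicits.
Arguments rack_connected R : clear implicits.

(* Main.v *)
Require Import Defs.
From HB Require Import structures.
From mathcomp Require Import all_boot.
From mathcomp Require Import boolp classical_sets functions.

(** Let [A] be a subrack of [R * S] containing [X].  Its two projections are
    subracks ([subrack_image]), so [A] projects onto [R] and onto [S].

    Write [T] for the set of those [r] in [R] such that moving the first
    coordinate by [r], and leaving the second alone, preserves [A].  If [s] acts
    trivially on [S] and [(r0, s)] is in [A], then [r0] is in [T].  Moreover [T]
    is invariant under every [r |-> r ^ q]: lift [q] to some [(q, t)] in [A];
    its action on [R * S] preserves [A] and conjugates the map
    [(x, u) |-> (x ^ r, u)] into [(x, u) |-> (x ^ (r ^ q), u)], because the
    action of [t] on the second coordinate cancels out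
    ([fst_stabilizer_invariant]).

    A nonempty invariant set in a connected rack is everything
    ([connected_invariant]).  Applied to [T], this gives [T = R]; in other words
    every slice [{x | (x, u) in A}] is invariant.  Each slice is nonempty, since
    [A] projects onto [S], so the same principle shows that each slice is all
    of [R]. *)

Set Implicit Arguments.
Unset Strict Implicit.

Local Open Scope classical_set_scope.
Local Open Scope rack_scope.

Lemma rack_op_inj (R : rackType) (y : R) : injective (fun x : R => x ^ y).
Proof. exact: bij_inj (rack_op_bij y). Qed.

Lemma rack_op_surj (R : rackType) (x y : R) : exists z : R, z ^ y = x.
Proof. by have [f _ fK] := rack_op_bij y; exists (f x); apply: fK. Qed.

(** Right translations are already injective on the whole rack, so restricting
    one of them to a bijection of [A] only constrains membership in [A]. *)
Lemma subrackP (R : rackType) (A : set R) :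
  subrack A <-> (forall x y : R, A y -> (A (x ^ y) <-> A x)).
Proof.
split=> [sA x y Ay|iA y Ay].
  have [AA _ Asurj] := sA y Ay.
  by split=> [/Asurj[z Az /rack_op_inj <-] //|]; apply: AA.
split=> [x Ax|x z _ _|x Ax]; first exact/iA.
  exact: rack_op_inj.
have [z zx] := rack_op_surj x y.
by exists z => //; apply/(iA z y Ay); rewrite zx.
Qed.

Lemma subrack_image (R S : rackType) (f : R -> S) (A : set R) :
  (forall x y, f (x ^ y) = f x ^ f y) -> subrack A -> subrack (f @` A).
Proof.
move=> fM sA; apply/subrackP => z _ [y Ay <-].
have iA := (subrackP A).1 sA; split=> [[w Aw fw]|[x Ax <-]]; last first.
  by exists (x ^ y); [apply/iA | apply: fM].
have [v vw] := rack_op_surj w y.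
exists v; first by apply/(iA v y Ay); rewrite vw.
by apply: (@rack_op_inj S (f y)); rewrite -fM vw.
Qed.

Lemma generates_subrack_image (R S : rackType) (f : R -> S)
    (X A : set R) :
  (forall x y, f (x ^ y) = f x ^ f y) -> generates (f @` X) ->
  subrack A -> X `<=` A -> f @` A = setT.
Proof.
by move=> fM Xgen sA XA; apply: Xgen; [apply: subrack_image | apply: image_subset].
Qed.

(** The automorphisms that preserve [P] form a subgroup of [Aut R]; when it
    contains the translations, it contains [Inn R]. *)
Lemma Inn_invariant (R : rackType) (P : set R) :
  (forall x q : R, P (x ^ q) <-> P x) ->
  forall (f : R -> R), Inn R f -> forall x, P (f x) <-> P x.
Proof.
move=> Pop f If.
suff: Inn R `<=` [set g | Aut R g /\ forall x, P (g x) <-> P x] by move/(_ f If) => [].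
have [_ A1 AM AV] := subgroup_of_Aut_Aut R.
apply: smallest_sub => [|_ [y _ <-]]; last first.
  split; last by move=> x; apply: Pop.
  by split=> [|x z]; [apply: rack_op_bij | apply: rack_op_distr].
split=> [g [] // | | g h [Ag Pg] [Ah Ph] | g h [Ag Pg] gK hK].
- by split.
- by split=> [|x]; [apply: AM | rewrite /= Pg].
- by split=> [|x]; [apply: AV gK hK | rewrite -{2}(hK x) Pg].
Qed.

(** The orbits of [Inn R] form a single class, so an invariant set that meets
    it contains it. *)
Lemma connected_invariant (R : rackType) (P : set R) :
  rack_connected R -> (forall x q : R, P (x ^ q) <-> P x) ->
  forall a : R, P a -> forall x, P x.
Proof.
move=> [C RC] Pop a Pa x.
have orbC y : Inn_orbit y = C.
  by have : connected_components R (Inn_orbit y) by [exists y]; rewrite RC.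
have : Inn_orbit x x by exists idfun => //; move=> G [[]].
by rewrite orbC -(orbC a) => -[f If <-]; apply/(Inn_invariant Pop If).
Qed.

Definition fst_stabilizer (R S : rackType) (A : set (R * S)%type) : set R :=
  [set r | forall x u, A (x ^ r, u) <-> A (x, u)].

(** Conjugating by an element [(q, t)] of [A] turns the translation by [r] in
    the first coordinate into the translation by [r ^ q]. *)
Lemma fst_stabilizer_invariant (R S : rackType) (A : set (R * S)%type) :
  subrack A -> fst @` A = setT ->
  forall r q : R, fst_stabilizer A (r ^ q) <-> fst_stabilizer A r.
Proof.
move=> /subrackP iA AR r q.
have : (fst @` A) q by rewrite AR.
case=> -[q' t] Aqt /= qq'; rewrite {q'}qq' in Aqt.
have act x u : A (x ^ q, u ^ t) <-> A (x, u) := iA (x, u) (q, t) Aqt.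
split=> Tr x u; first by rewrite -act rack_op_distr Tr act.
have [y <-] := rack_op_surj x q; have [v <-] := rack_op_surj u t.
by rewrite -rack_op_distr !act Tr.
Qed.

Theorem corollary5p1p50 (R S : rackType)
    (R_connected : rack_connected R)
    (InnS_abelian : Inn_abelian S)
    (S_trivial_elt : exists s : S, forall x : S, x ^ s = x)
    (X : set (R * S)%type)
    (XR : generates (fst @` X))
    (XS : generates (snd @` X)) :
  generates X.
Proof.
move=> A sA XA.
have AR : fst @` A = setT by apply: generates_subrack_image XR sA XA.
have AS : snd @` A = setT by apply: generates_subrack_image XS sA XA.
have [s s_triv] := S_trivial_elt.
have [[r0 s'] Ars /= ss'] : (snd @` A) s by rewrite AS.
rewrite {s'}ss' in Ars.
have Tr0 : fst_stabilizer A r0.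
  move=> x u; rewrite -{1}(s_triv u).
  exact: ((subrackP A).1 sA (x, u) (r0, s) Ars).
have TR : forall r, fst_stabilizer A r.
  by apply: connected_invariant Tr0 => //; apply: fst_stabilizer_invariant.
apply/seteqP; split=> // -[x u] _.
have [[x0 u'] Axu /= uu'] : (snd @` A) u by rewrite AS.
rewrite {u'}uu' in Axu.
apply: (connected_invariant (P := [set y | A (y, u)]) R_connected _ Axu).
by move=> y q; apply: TR.
Qed.
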